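(* Let $n$ be a positive integer with decimal expansion $d_1 d_2 \ldots d_k$ (so $d_1 \neq 0$), and let $M_1(n)$ denote the largest number that can be obtained from $n$ by one Choix de Bruxelles operation. If every digit satisfies $d_i < 5$, then $M_1(n) = 2n$. Otherwise, let $p$ be the largest index with $d_p \ge 5$; then $M_1(n)$ is the number obtained by doubling the substring $d_p d_{p+1}\ldots d_k$, i.e. $M_1(n)$ is the number whose decimal expansion is $d_1 \ldots d_{p-1}$ followed by the decimal expansion of $2\cdot(d_p d_{p+1}\ldots d_k)$.
   Context: The Choix de Bruxelles operation: given a positive integer $n$ with decimal expansion $d_1 d_2 \ldots d_k$, choose indices $1 \le p \le q \le k$ with $d_p \neq 0$, let $s$ be the number with decimal representation $d_p d_{p+1}\ldots d_q$, and replace this substring in situ by the decimal expansion of $2s$, or, if $s$ is even, by the decimal expansion of $s/2$. One may also leave $n$ unchanged (empty substring). For example, $16$ can become any of $16, 26, 13, 112, 8, 32$. *)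

(* Defs.v *)
From mathcomp Require Import all_boot.

Set Implicit Arguments.
Unset Strict Implicit.
Unset Printing Implicit Defensive.

(* Digit strings are sequences of naturals, most significant digit first;
   positions in them are numbered from 1. *)

Definition undigits (d : seq nat) : nat := foldl (fun a x => 10 * a + x) 0 d.

(* A positive n has (trunc_log 10 n).+1 decimal digits; digits 0 = [:: 0]. *)
Definition digits (n : nat) : seq nat :=
  [seq n %/ 10 ^ i %% 10 | i <- rev (iota 0 (trunc_log 10 n).+1)].

Definition digit (d : seq nat) (i : nat) : nat := nth 0 d i.-1.

(* The substring d_p ... d_q. *)
Definition substring (d : seq nat) (p q : nat) : seq nat := drop p.-1 (take q d).

(* The number obtained from d when the substring d_p ... d_q is replaced in
   situ by the decimal expansion of t. *)
Definition replace (d : seq nat) (p q t : nat) : nat :=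
  undigits (take p.-1 d ++ digits t ++ drop q d).

Definition moves (d : seq nat) (p q : nat) : seq nat :=
  if digit d p == 0 then [::] else
  let s := undigits (substring d p q) in
  replace d p q (2 * s) :: (if odd s then [::] else [:: replace d p q s./2]).

Definition choix (n : nat) : seq nat :=
  let d := digits n in
  let k := size d in
  n :: flatten [seq moves d p q | p <- iota 1 k, q <- iota p (k.+1 - p)].

Definition M1 (n : nat) : nat := \max_(m <- choix n) m.

Lemma undigits_rcons d x : undigits (rcons d x) = 10 * undigits d + x.
Proof. by rewrite /undigits -cats1 foldl_cat. Qed.

Lemma digits_lt10 n : all (fun x => x < 10) (digits n).
Proof. by apply/allP => _ /mapP[i _ ->]; rewrite ltn_mod. Qed.

Lemma digitsK n : undigits (digits n) = n.
Proof.
suff H k m : m < 10 ^ k ->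
    undigits [seq m %/ 10 ^ i %% 10 | i <- rev (iota 0 k)] = m.
  exact/H/trunc_log_ltn.
elim: k m => [|k IH] m; first by rewrite expn0 ltnS leqn0 => /eqP ->.
move=> mlt; rewrite -[iota 0 k.+1]/(0 :: iota (1 + 0) k) iotaDl rev_cons.
rewrite map_rcons undigits_rcons -map_rev -map_comp expn0 divn1.
rewrite [map _ _](_ : _ = [seq m %/ 10 %/ 10 ^ i %% 10 | i <- rev (iota 0 k)]).
  by rewrite IH ?ltn_divLR -?expnSr // mulnC -divn_eq.
by apply: eq_map => i /=; rewrite add1n expnS divnMA.
Qed.

Lemma digit1_digits n : 0 < n -> digit (digits n) 1 != 0.
Proof.
move=> n0; rewrite /digit /digits -[X in iota 0 X]addn1 iotaD rev_cat /= add0n.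
have /andP[lo hi] := trunc_log_bounds (isT : 1 < 10) n0.
rewrite modn_small ?ltn_divLR ?expn_gt0 -?expnS //.
by rewrite -lt0n divn_gt0 ?expn_gt0.
Qed.

Lemma choixP n m (d := digits n) : reflect
  (m = n \/ exists p q, [/\ 1 <= p <= q, q <= size d, digit d p <> 0 &
     let s := undigits (substring d p q) in
     m = replace d p q (2 * s) \/ ~~ odd s /\ m = replace d p q s./2])
  (m \in choix n).
Proof.
rewrite inE; apply: (iffP orP) => -[/eqP|]; [by left| |by left|].
  case/flattenP => _ /allpairsPdep[p [q [pI qI ->]]].
  rewrite /moves; case: eqP => // dp; move: pI qI; rewrite !mem_iota.
  move=> /andP[p1 pk] /andP[pq]; rewrite (subnKC (ltnW pk)) ltnS => qk.
  rewrite inE => H; right; exists p, q; split=> //; first by rewrite p1.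
  case/orP: H => [/eqP|]; first by left.
  by case: ifP => // e; rewrite inE => /eqP ->; right.
case=> p [q [/andP[p1 pq] qk dp H]]; right; apply/flattenP.
have pk := leq_trans pq qk.
exists (moves d p q).
  apply/allpairsPdep; exists p, q; rewrite !mem_iota p1 pq.
  by rewrite add1n ltnS pk (subnKC (leqW pk)) ltnS.
rewrite /moves; case: eqP => // _; rewrite inE.
case: H => [->|[/negPf-> ->]]; first by rewrite eqxx.
by rewrite inE eqxx orbT.
Qed.

(* Main.v *)
Require Import Defs.
From mathcomp Require Import all_boot zify.

Set Implicit Arguments.
Unset Strict Implicit.
Unset Printing Implicit Defensive.

(** A move replaces a substring [s] of [n = a ++ s ++ b] by the expansion of a
    number at most [2 * s], which is at most one digit longer than [s].  If it
    is not longer, the result is at most [2 * n].  If it is longer, then [s]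
    starts with a digit at least 5 and [a] moves one place to the left, which
    multiplies its contribution by 10 rather than 2.  So the result is at most
    [2 * n] plus 8 times the truncation of [n] to [a] followed by zeros, with
    equality when [s] is a suffix and is doubled.  The truncation grows with
    [a], so the last digit at least 5 is the best place to start. *)

Local Notation decimal := (all (fun x => x < 10)).

Implicit Types (a b d s u v : seq nat) (c e i j k m n p q t x : nat).

Lemma undigits_cat u v :
  undigits (u ++ v) = undigits u * 10 ^ size v + undigits v.
Proof.
elim/last_ind: v => [|v x IH]; first by rewrite cats0 muln1 addn0.
by rewrite -rcons_cat !undigits_rcons IH size_rcons expnS; lia.
Qed.

Lemma undigits_cons x u : undigits (x :: u) = x * 10 ^ size u + undigits u.
Proof. by rewrite -cat1s undigits_cat. Qed.

Lemma undigits_lt u : decimal u -> undigits u < 10 ^ size u.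
Proof.
elim: u => //= x u IH /andP[x_lt10 /IH u_lt].
by rewrite undigits_cons expnS; nia.
Qed.

Lemma undigits_inj u v : size u = size v -> decimal u -> decimal v ->
  undigits u = undigits v -> u = v.
Proof.
elim: u v => [|x u IH] [|y v] //= [eq_size] /andP[_ u_dec] /andP[_ v_dec].
have u_lt := undigits_lt u_dec; have v_lt := undigits_lt v_dec.
rewrite !undigits_cons eq_size in u_lt * => eq_uv.
have eq_xy : x = y by nia.
by rewrite eq_xy (IH v) //; nia.
Qed.

Lemma undigits_double_carry x u : decimal u ->
  (10 ^ (size u).+1 <= 2 * undigits (x :: u)) = (5 <= x).
Proof. by move=> /undigits_lt u_lt; rewrite undigits_cons expnS; nia. Qed.

Lemma size_digits n : size (digits n) = (trunc_log 10 n).+1.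
Proof. by rewrite size_map size_rev size_iota. Qed.

Lemma size_digits_leq n k : 0 < k -> (size (digits n) <= k) = (n < 10 ^ k).
Proof.
move=> k_gt0; rewrite size_digits; apply/idP/idP => [le_k|].
  by apply: leq_trans (trunc_log_ltn n (isT : 1 < 10)) _; rewrite leq_exp2l.
case: (posnP n) => [->|n_gt0 n_lt]; first by rewrite trunc_log0.
by rewrite -(@ltn_exp2l 10) //; apply: leq_ltn_trans (trunc_logP _ _) n_lt.
Qed.

Lemma undigitsK u : decimal u -> digit u 1 != 0 -> digits (undigits u) = u.
Proof.
case: u => // x u u_dec; rewrite /digit -lt0n /= => x_gt0.
apply: undigits_inj; rewrite ?digitsK ?digits_lt10 //.
apply/eqP; rewrite eqn_leq size_digits_leq // undigits_lt //=.
case: u u_dec => [|y u] _; first by rewrite size_digits.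
by rewrite ltnNge size_digits_leq // -leqNgt undigits_cons; nia.
Qed.

Lemma size_digits_double x u : decimal (x :: u) -> 5 <= x ->
  size (digits (2 * undigits (x :: u))) = (size u).+2.
Proof.
move=> xu_dec x_ge5; have /andP[_ u_dec] := xu_dec.
apply/eqP; rewrite eqn_leq ltnNge !size_digits_leq // -leqNgt.
rewrite undigits_double_carry // x_ge5 andbT.
by have := undigits_lt xu_dec; rewrite /= !expnS; lia.
Qed.

Definition truncation d i : nat := undigits (take i d) * 10 ^ (size d - i).

Lemma truncation_size_cat a u :
  truncation (a ++ u) (size a) = undigits a * 10 ^ size u.
Proof. by rewrite /truncation take_size_cat // size_cat addKn. Qed.

Lemma leq_truncation d : {homo truncation d : i j / i <= j}.
Proof.
apply: homo_leq => [//|j i k|i]; first exact: leq_trans.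
rewrite /truncation; have [lt_i|le_i] := ltnP i (size d).
  by rewrite (take_nth 0) // undigits_rcons -(subnSK lt_i) expnS; nia.
have -> : size d - i = size d - i.+1 by lia.
by rewrite !take_oversize ?(leqW le_i).
Qed.

Lemma undigits_scale_suffix c e a u v :
  c <= 10 ^ e -> undigits v = c * undigits u -> size v = e + size u ->
  undigits (a ++ v) =
  c * undigits (a ++ u) + (10 ^ e - c) * truncation (a ++ u) (size a).
Proof.
move=> c_le v_eq size_v; rewrite truncation_size_cat !undigits_cat v_eq size_v.
by rewrite expnD mulnDr addnAC -mulnDl subnKC // mulnCA.
Qed.

(* The subtraction is truncated: the last term vanishes when [10 ^ e <= c]. *)
Lemma leq_undigits_replace c e a s v b (d := a ++ s ++ b) :
  0 < c -> undigits v <= c * undigits s -> size v <= e + size s ->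
  undigits (a ++ v ++ b) <=
  c * undigits d + (10 ^ e - c) * truncation d (size a).
Proof.
move=> c_gt0 v_le; rewrite -(@leq_exp2l 10) // expnD => size_v.
rewrite truncation_size_cat !undigits_cat !size_cat !expnD.
have prefix_le : undigits a * (10 ^ size v * 10 ^ size b) <=
    (c + (10 ^ e - c)) * (undigits a * (10 ^ size s * 10 ^ size b)).
  rewrite [leqRHS]mulnCA leq_mul2l; apply/orP; right; rewrite mulnA leq_mul2r.
  by rewrite (leq_trans size_v) ?orbT // leq_mul2r; apply/orP; right; lia.
have := leq_mul v_le (leqnn (10 ^ size b)).
have := leq_pmull (undigits b) c_gt0.
by lia.
Qed.

Lemma undigits_replace_bound a x s b t (d := a ++ (x :: s) ++ b) :
  decimal (x :: s) -> t <= 2 * undigits (x :: s) ->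
  undigits (a ++ digits t ++ b) <= 2 * undigits d \/
  5 <= x /\ undigits (a ++ digits t ++ b) <=
            2 * undigits d + 8 * truncation d (size a).
Proof.
move=> xs_dec t_le; have /andP[_ s_dec] := xs_dec.
have replace_le e : size (digits t) <= e + (size s).+1 ->
    undigits (a ++ digits t ++ b) <=
    2 * undigits d + (10 ^ e - 2) * truncation d (size a).
  by move=> size_t; apply: leq_undigits_replace; rewrite ?digitsK.
have [t_short|t_long] := ltnP t (10 ^ (size s).+1).
  left; rewrite -[leqRHS]addn0; apply: (replace_le 0).
  by rewrite size_digits_leq.
right; split.
  by rewrite -(undigits_double_carry _ s_dec) (leq_trans t_long).
apply: (replace_le 1); rewrite size_digits_leq //.
by have := undigits_lt xs_dec; rewrite /= !expnS; lia.
Qed.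

Lemma digit_geq_leq d p i x : 0 < x ->
  (forall j, p < j <= size d -> digit d j < x) -> x <= digit d i -> i <= p.
Proof.
move=> x_gt0 ltx x_le; rewrite leqNgt; apply/negP => lt_pi.
have [le_i|lt_i] := leqP i (size d).
  by have := ltx i; rewrite lt_pi le_i ltnNge x_le => /(_ isT).
move: x_le; rewrite /digit nth_default; first by rewrite leqNgt x_gt0.
by rewrite -ltnS (ltn_predK lt_i).
Qed.

Lemma substring_cons d p q : 1 <= p <= q -> q <= size d ->
  substring d p q = digit d p :: drop p (take q d).
Proof.
case: p => // p p_lt q_le; rewrite /substring /digit /= (drop_nth 0).
  by rewrite nth_take.
by rewrite size_takel.
Qed.

Lemma cat_take_substring_drop d p q : p.-1 <= q ->
  take p.-1 d ++ substring d p q ++ drop q d = d.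
Proof.
by move=> le_pq; rewrite /substring catA -(take_takel d le_pq) !cat_take_drop.
Qed.

Lemma choix_bound n m (d := digits n) : m \in choix n ->
  m <= 2 * n \/
  exists p, [/\ 1 <= p, 5 <= digit d p & m <= 2 * n + 8 * truncation d p.-1].
Proof.
case/choixP => [->|[p [q [/[dup] p_bounds /andP[p_gt0 le_pq] q_le _ m_eq]]]].
  by left; lia.
rewrite -/d in q_le m_eq; set s := substring d p q in m_eq.
have [t t_le ->] : exists2 t, t <= 2 * undigits s & m = replace d p q t.
  case: m_eq => [->|[_ ->]]; first by exists (2 * undigits s).
  by exists (undigits s)./2 => //; lia.
have d_eq : take p.-1 d ++ s ++ drop q d = d.
  by apply: cat_take_substring_drop; lia.
have size_prefix : size (take p.-1 d) = p.-1 by rewrite size_takel //; lia.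
have s_dec : decimal s.
  by have := digits_lt10 n; rewrite -/d -d_eq !all_cat => /and3P[].
rewrite /s substring_cons // in t_le s_dec d_eq.
have := undigits_replace_bound (take p.-1 d) (drop q d) s_dec t_le.
rewrite d_eq size_prefix digitsK => -[m_le|[ge5 m_le]]; first by left.
by right; exists p.
Qed.

Lemma mem_choix_double_suffix n p (d := digits n) (k := size d) :
  1 <= p <= k -> digit d p != 0 ->
  undigits (take p.-1 d ++ digits (2 * undigits (substring d p k))) \in choix n.
Proof.
move=> p_bounds /eqP dp_neq0; apply/choixP; right; exists p, k; split=> //=.
by left; rewrite /replace drop_size cats0.
Qed.

Lemma mem_choix_double n : 0 < n -> 2 * n \in choix n.
Proof.
move=> n_gt0; have := @mem_choix_double_suffix n 1.
rewrite /substring take_size /= take0 drop0 /= !digitsK.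
by apply; [rewrite size_digits | exact: digit1_digits].
Qed.

Lemma M1_eq n m : m \in choix n ->
  (forall m', m' \in choix n -> m' <= m) -> M1 n = m.
Proof.
move=> m_choix m_max; apply/eqP; rewrite eqn_leq /M1; apply/andP; split.
  by apply/bigmax_leqP_seq => i ? _; apply: m_max.
exact: (leq_bigmax_seq m).
Qed.

Lemma undigits_double_substring n p (d := digits n) (k := size d) :
  1 <= p <= k -> 5 <= digit d p ->
  undigits (take p.-1 d ++ digits (2 * undigits (substring d p k))) =
  2 * n + 8 * truncation d p.-1.
Proof.
move=> p_bounds ge5; have /andP[p_gt0 le_pk] := p_bounds.
have d_eq : take p.-1 d ++ substring d p k = d.
  by rewrite /substring take_size cat_take_drop.
have s_dec : decimal (substring d p k).
  by have := digits_lt10 n; rewrite -/d -{1}d_eq all_cat => /andP[].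
rewrite (@undigits_scale_suffix 2 1 _ (substring d p k)) ?digitsK //.
  by rewrite d_eq digitsK size_takel //; lia.
by rewrite substring_cons // in s_dec *; rewrite size_digits_double.
Qed.

Lemma undigits_take_catK n p t (d := digits n) : 0 < n -> 0 < t ->
  digits (undigits (take p d ++ digits t)) = take p d ++ digits t.
Proof.
move=> n_gt0 t_gt0; apply: undigitsK.
  rewrite all_cat digits_lt10 andbT.
  have := digits_lt10 n.
  by rewrite -[digits n](cat_take_drop p) all_cat => /andP[].
have := digit1_digits n_gt0; rewrite -/d.
by case: p d => [|p] [|x d] //= _; apply: digit1_digits.
Qed.

Theorem theorem1 (n : nat) (n_gt0 : 0 < n) :
  let d := digits n in
  let k := size d in
  ((forall i, 1 <= i <= k -> digit d i < 5) -> M1 n = 2 * n) /\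
  (forall p, 1 <= p <= k -> 5 <= digit d p ->
     (forall i, p < i <= k -> digit d i < 5) ->
     digits (M1 n) =
       take p.-1 d ++ digits (2 * undigits (substring d p k))).
Proof.
move=> d k.
split=> [lt5|p p_bounds p_ge5 lt5].
  apply: M1_eq => [|m /choix_bound[//|[i [i_gt0 i_ge5 _]]]].
    exact: mem_choix_double.
  by have := digit_geq_leq (isT : 0 < 5) lt5 i_ge5; rewrite leqNgt i_gt0.
have dp_neq0 : digit d p != 0 by lia.
rewrite (M1_eq (mem_choix_double_suffix p_bounds dp_neq0)) => [|m].
  rewrite undigits_take_catK // substring_cons // undigits_cons.
  by rewrite muln_gt0 addn_gt0 muln_gt0 expn_gt0 andbT (leq_trans _ p_ge5).
rewrite undigits_double_substring // => /choix_bound[m_le|]; first by lia.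
case=> i [i_gt0 i_ge5 m_le]; apply: leq_trans m_le _.
have le_ip : i <= p := digit_geq_leq (isT : 0 < 5) lt5 i_ge5.
by rewrite leq_add2l leq_mul2l leq_truncation //; lia.
Qed.
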